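(* Let $R$ be a commutative ring. The maximal spectrum $\operatorname{Max}(R)$ is compact with respect to the flat topology if and only if $R/J(R)$ is absolutely flat, where $J(R)$ is the Jacobson radical of $R$.
   Context: All rings are commutative (with identity). For $f\in R$, put $V(f)=\{\mathfrak{p}\in\operatorname{Spec}(R): f\in\mathfrak{p}\}$. The flat (or inverse) topology on $\operatorname{Spec}(R)$ is the topology having the collection of subsets $V(f)$, with $f\in R$, as a sub-basis of opens. $\operatorname{Max}(R)$ is the set of maximal ideals of $R$, with the subspace topology induced from the flat topology on $\operatorname{Spec}(R)$. Compact means quasi-compact and Hausdorff. A ring $R$ is absolutely flat (von Neumann regular) if each $R$-module is flat; equivalently, each $f\in R$ can be written as $f=f^{2}g$ for some $g\in R$. *)

(* Defs.v *)
From HB Require Import structures.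
From mathcomp Require Import all_boot all_order all_algebra.
From mathcomp Require Import generic_quotient ring_quotient freeg.
From mathcomp Require Import all_classical.
From mathcomp Require Import topology.

Set Implicit Arguments.
Unset Strict Implicit.
Unset Printing Implicit Defensive.

Import GRing.Theory.

Local Open Scope classical_set_scope.
Local Open Scope quotient_scope.
Local Open Scope ring_scope.

(* The base structure is comPzRingType, so that the zero ring is a ring.  The
   ideals and quotient rings of ring_quotient are restricted to proper ideals
   of nonzero rings, hence the definitions below. *)

Section Ideals.
Variable R : comPzRingType.

Definition is_ideal (I : set R) : Prop :=
  [/\ I 0, (forall x y, I x -> I y -> I (x + y))
    & (forall a x, I x -> I (a * x))].

Definition prime_ideal (p : set R) : Prop :=
  [/\ is_ideal p, p <> setT & forall x y, p (x * y) -> p x \/ p y].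

Definition maximal_ideal (m : set R) : Prop :=
  [/\ is_ideal m, m <> setT
    & forall I, is_ideal I -> m `<=` I -> I = m \/ I = setT].

Record ideal := Ideal { ideal_set :> set R; idealP : is_ideal ideal_set }.

(* In the zero ring the intersection is empty and the radical is setT. *)
Definition jacobson_set : set R := \bigcap_(m in maximal_ideal) m.

Lemma jacobson_is_ideal : is_ideal jacobson_set.
Proof.
split=> [m [[]] //|x y Jx Jy m mm|a x Jx m mm].
- by have [[_ D _] _ _] := mm; apply: D; [exact: Jx|exact: Jy].
- by have [[_ _ M] _ _] := mm; apply: M; exact: Jx.
Qed.

Definition jacobson : ideal := Ideal jacobson_is_ideal.

End Ideals.

Section QuotientRing.
Variables (R : comPzRingType) (I : ideal R).

Definition ideal_mem (x : R) : bool := x \in ideal_set I.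

Lemma ideal_mem_zmod_closed : zmod_closed ideal_mem.
Proof.
have [I0 ID IM] := idealP I.
split=> [|x y]; rewrite !unfold_in; first exact/mem_set.
move=> /set_mem Ix /set_mem Iy; apply/mem_set.
by rewrite -mulN1r; apply: ID => //; exact: IM.
Qed.

HB.instance Definition _ :=
  GRing.isZmodClosed.Build R ideal_mem ideal_mem_zmod_closed.

Definition quotient_ring : Type := Quotient.quot (GRing.ZmodClosed.clone R ideal_mem _).

HB.instance Definition _ := GRing.Zmodule.on quotient_ring.
HB.instance Definition _ := EqQuotient.on quotient_ring.

Lemma quotient_ringP (x y : R) :
  \pi_quotient_ring x = \pi_quotient_ring y <-> ideal_set I (x - y).
Proof.
split=> [/eqP|h]; first by rewrite -Quotient.idealrBE => /set_mem.
by apply/eqP; rewrite -Quotient.idealrBE; exact/mem_set.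
Qed.

Definition quotient_one : quotient_ring := \pi_quotient_ring 1.
Definition quotient_mul (x y : quotient_ring) : quotient_ring :=
  \pi_quotient_ring (repr x * repr y).

Lemma quotient_mulE (x y : R) :
  quotient_mul (\pi_quotient_ring x) (\pi_quotient_ring y) = \pi_quotient_ring (x * y).
Proof.
have [_ ID IM] := idealP I.
apply/quotient_ringP.
set a := repr _; set b := repr _.
have -> : a * b - x * y = b * (a - x) + x * (b - y).
  by rewrite !mulrBr addrA [b * a]mulrC [b * x]mulrC subrK.
by apply: ID; apply: IM; apply/quotient_ringP; rewrite /a /b reprK.
Qed.

Let quotient_addE (x y : R) :
  \pi_quotient_ring x + \pi_quotient_ring y = \pi_quotient_ring (x + y).
Proof.
symmetry.
exact: (Quotient.pi_add (GRing.ZmodClosed.clone R ideal_mem _) x y).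
Qed.

Lemma quotient_mulA : associative quotient_mul.
Proof.
move=> x y z; elim/quotW: x => x; elim/quotW: y => y; elim/quotW: z => z.
by rewrite (quotient_mulE y z) (quotient_mulE x y) !(quotient_mulE _ z)
  quotient_mulE mulrA.
Qed.

Lemma quotient_mulC : commutative quotient_mul.
Proof.
by move=> x y; elim/quotW: x => x; elim/quotW: y => y; rewrite !quotient_mulE mulrC.
Qed.

Lemma quotient_mul1 : left_id quotient_one quotient_mul.
Proof. by move=> x; elim/quotW: x => x; rewrite quotient_mulE mul1r. Qed.

Lemma quotient_mulDl : left_distributive quotient_mul +%R.
Proof.
move=> x y z; elim/quotW: x => x; elim/quotW: y => y; elim/quotW: z => z.
by rewrite quotient_addE (quotient_mulE x z) (quotient_mulE y z) quotient_mulE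
  quotient_addE mulrDl.
Qed.

HB.instance Definition _ := GRing.Zmodule_isComPzRing.Build quotient_ring
  quotient_mulA quotient_mulC quotient_mul1 quotient_mulDl.

End QuotientRing.

Section FlatTopology.
Variable R : comPzRingType.

Record Spec := MkSpec { Spec_set :> set R; SpecP : prime_ideal Spec_set }.

HB.instance Definition _ := gen_eqMixin Spec.
HB.instance Definition _ := gen_choiceMixin Spec.

Definition V (f : R) : set Spec := [set p : Spec | Spec_set p f].

(* The subbase is the family range V, indexed by itself. *)
HB.instance Definition _ := isSubBaseTopological.Build Spec (range V) id.

(* A set coerces to the type of its elements, on which topology puts the
   topology induced by the inclusion. *)
Definition Max : set Spec := [set p : Spec | maximal_ideal (Spec_set p)].

End FlatTopology.

Arguments Max : clear implicits.

(* The library's compact is quasi-compactness, without separation. *)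
Definition compact_hausdorff (T : topologicalType) : Prop :=
  compact [set: T] /\ hausdorff_space T.

Section Tensor.
Variables (S : comPzRingType) (N M : lmodType S).

(* The subgroup of the free abelian group on N * M generated by the relations
   of the tensor product. *)
Inductive tensor_rel : {freeg (N * M)%type} -> Prop :=
| tensor_relDl n n' m :
    tensor_rel (<< (n + n', m) >> - << (n, m) >> - << (n', m) >>)
| tensor_relDr n m m' :
    tensor_rel (<< (n, m + m') >> - << (n, m) >> - << (n, m') >>)
| tensor_relZ a n m :
    tensor_rel (<< (a *: n, m) >> - << (n, a *: m) >>)
| tensor_rel0 : tensor_rel 0
| tensor_relB g h : tensor_rel g -> tensor_rel h -> tensor_rel (g - h).

Definition tensor_rel_mem (g : {freeg (N * M)%type}) : bool :=
  `[< tensor_rel g >].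

Lemma tensor_rel_zmod_closed : zmod_closed tensor_rel_mem.
Proof.
split=> [|g h]; rewrite !unfold_in; first exact/asboolP/tensor_rel0.
by move=> /asboolP gr /asboolP hr; exact/asboolP/tensor_relB.
Qed.

HB.instance Definition _ :=
  GRing.isZmodClosed.Build _ tensor_rel_mem tensor_rel_zmod_closed.

(* Only the underlying abelian group of the tensor product is needed to state
   flatness. *)
Definition tensor : Type := Quotient.quot (GRing.ZmodClosed.clone _ tensor_rel_mem _).

HB.instance Definition _ := GRing.Zmodule.on tensor.
HB.instance Definition _ := EqQuotient.on tensor.

Definition tensor_pi (g : {freeg (N * M)%type}) : tensor := \pi_tensor g.

Definition tens (n : N) (m : M) : tensor := tensor_pi << (n, m) >>.

Lemma tensor_piP g h : tensor_pi g = tensor_pi h <-> tensor_rel (g - h).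
Proof.
split=> [/eqP|r]; first by rewrite -Quotient.idealrBE => /asboolP.
by apply/eqP; rewrite -Quotient.idealrBE; exact/asboolP.
Qed.

Lemma tensor_piB : {morph tensor_pi : g h / g - h}.
Proof.
move=> g h; rewrite /tensor_pi.
rewrite [LHS](Quotient.pi_add (GRing.ZmodClosed.clone _ tensor_rel_mem _)).
by congr (_ + _); exact: (Quotient.pi_opp (GRing.ZmodClosed.clone _ _ _)).
Qed.

Lemma tensDl n n' m : tens (n + n') m = tens n m + tens n' m.
Proof.
apply/eqP; rewrite -subr_eq -tensor_piB; apply/eqP/tensor_piP.
by rewrite addrAC; exact: tensor_relDl.
Qed.

Lemma tensDr n m m' : tens n (m + m') = tens n m + tens n m'.
Proof.
apply/eqP; rewrite -subr_eq -tensor_piB; apply/eqP/tensor_piP.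
by rewrite addrAC; exact: tensor_relDr.
Qed.

Lemma tensZ a n m : tens (a *: n) m = tens n (a *: m).
Proof. exact/tensor_piP/tensor_relZ. Qed.

End Tensor.

Section FreeGroupExtension.
Variables (K : choiceType) (A : zmodType).

Definition freeg_ext (h : K -> A) (g : {freeg K}) : A :=
  \sum_(k <- dom g) h k *~ coeff k g.

HB.instance Definition _ (f : K -> zmodule A) :=
  GRing.isZmodMorphism.Build {freeg K} (zmodule A) (fglift f)
    (lift_is_additive f).

Lemma freeg_extE (h : K -> A) (g : {freeg K}) :
  freeg_ext h g = fglift (h : K -> zmodule A) g.
Proof.
rewrite -[in RHS](freeg_sumE g) raddf_sum /=.
by apply: eq_bigr => k _; rewrite liftU.
Qed.

Lemma freeg_extB (h : K -> A) : {morph freeg_ext h : g g' / g - g'}.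
Proof. by move=> g g'; rewrite !freeg_extE raddfB. Qed.

Lemma freeg_extU (h : K -> A) (k : K) : freeg_ext h << k >> = h k.
Proof. by rewrite freeg_extE liftU scale1r. Qed.

End FreeGroupExtension.

Section Flatness.
Variable S : comPzRingType.

(* The map f (x) id_M, computed on a representative; it does not depend on the
   representative when f is linear (tensor_map_pi below). *)
Definition tensor_map (N N' M : lmodType S) (f : N -> N') (t : tensor N M) :
    tensor N' M :=
  freeg_ext (fun k : N * M => tens (f k.1) k.2) (repr t).

Definition flat_module (M : lmodType S) : Prop :=
  forall (N N' : lmodType S) (f : {linear N -> N'}),
    injective f -> injective (@tensor_map N N' M f).

Definition absolutely_flat : Prop := forall M : lmodType S, flat_module M.

Lemma tensor_map_pi (N N' M : lmodType S) (f : {linear N -> N'})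
    (g : {freeg (N * M)%type}) :
  tensor_map f (tensor_pi g) =
  freeg_ext (fun k : N * M => tens (f k.1) k.2) g.
Proof.
have ext0 k : tensor_rel k ->
    freeg_ext (fun k : N * M => tens (f k.1) k.2 : tensor N' M) k = 0.
  elim=> {k} [n n' m|n m m'|a n m||k l _ k0 _ l0].
  - by rewrite !freeg_extB !freeg_extU /= raddfD tensDl -addrA -opprD subrr.
  - by rewrite !freeg_extB !freeg_extU /= tensDr -addrA -opprD subrr.
  - by rewrite !freeg_extB !freeg_extU /= linearZ tensZ subrr.
  - by rewrite -(subrr (0 : {freeg (N * M)%type})) freeg_extB subrr.
  - by rewrite freeg_extB k0 l0 subrr.
apply/eqP; rewrite -subr_eq0 -freeg_extB ext0 //.
by apply/tensor_piP; rewrite /tensor_pi reprK.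
Qed.

Lemma tensor_map_tens (N N' M : lmodType S) (f : {linear N -> N'}) n m :
  tensor_map f (tens n m) = tens (f n) m :> tensor N' M.
Proof. by rewrite tensor_map_pi freeg_extU. Qed.

End Flatness.

(* Main.v *)
Require Import Defs.
From HB Require Import structures.
From mathcomp Require Import all_boot all_order all_algebra.
From mathcomp Require Import finmap generic_quotient freeg ring.
From mathcomp Require Import all_classical.
From mathcomp Require Import topology.

(** Both sides say that for every f there is g such that each maximal ideal
    contains f or 1 - f g; this is f - f^2 g \in J(R), that is, von Neumann
    regularity of R/J(R).

    On the topological side, f \notin m means that 1 - f g \in m for some g, so
    Max(R) is covered by the opens V(f) and V(1 - f g), g \in R.  The elements
    1 - f g are closed under multiplication, hence a finite subcover yields a
    single g that works for all m ([compact_regular]).  Conversely such a g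
    makes V(f) and V(1 - f g) complementary in Max(R).  This separates points,
    and it makes {f | V(f) \in F} a maximal ideal for every ultrafilter F on
    Max(R), to which F converges ([regular_hausdorff], [regular_compact]).

    On the module side, let S be the quotient ring.  If S is absolutely flat,
    tensoring the embedding a : S/Ann(a) -> S with S/(a) sends 1 (x) 1 to
    a (x) 1 = 1 (x) a = 0, so 1 = 0 in
    S/Ann(a) (x) S/(a) = S/(Ann(a) + (a)), and a \in (a^2)
    ([absolutely_flat_regular]).

    Let S be regular, f : N -> N' injective, and suppose that a nonzero
    t \in N (x) M dies in N' (x) M.  Choose a submodule C of N' maximal among
    those such that t survives in N/f^-1(C) (x) M.  By maximality every
    idempotent acts on N'/C as 0 or 1, so N'/C is a vector space over a residue
    field of S and its submodules are its subspaces; again by maximality the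
    image of N meets each nonzero one nontrivially, hence N' = f(N) + C.
    Therefore N/f^-1(C) -> N'/C is an isomorphism and t cannot die in N' (x) M
    ([regular_tensor_map_ker]). *)

Set Implicit Arguments.
Unset Strict Implicit.
Unset Printing Implicit Defensive.

Import GRing.Theory.

Local Open Scope classical_set_scope.
Local Open Scope quotient_scope.
Local Open Scope ring_scope.

(** * Maximal ideals and the flat topology *)

Section FlatMaximalSpectrum.
Variable R : comPzRingType.
Implicit Types (f g u : R) (m : Max R).

Definition maximal_at m : set R := Spec_set (set_val m).

Lemma maximal_atP m : maximal_ideal (maximal_at m).
Proof. exact: (set_valP m). Qed.

Lemma maximal_at_prime m : prime_ideal (maximal_at m).
Proof. exact: SpecP. Qed.

Lemma maximal_at_inj : injective maximal_at.
Proof.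
move=> m m' e; apply: val_inj.
move: e; rewrite /maximal_at /=; rewrite /set_val /=.
case: (\val m) (\val m') => [p pp] [q qp] /= e; rewrite -{}e in qp *.
by rewrite (Prop_irrelevance pp qp).
Qed.

Lemma proper_ideal1 (p : set R) : is_ideal p -> p <> setT -> ~ p 1.
Proof.
move=> [_ _ pM] pT p1; apply: pT; apply/seteqP; split=> // x _.
by rewrite -[x]mulr1; exact: pM.
Qed.

Lemma maximal_inverse (p : set R) f : maximal_ideal p -> ~ p f ->
  exists g, p (1 - f * g).
Proof.
move=> [[p0 pD pM] pT pmax] npf.
pose I := [set x | exists a b, p a /\ x = a + f * b].
have idI : is_ideal I.
  split=> [|x y [a [b [pa ->]]] [c [d [pc ->]]]|r x [a [b [pa ->]]]].
  - by exists 0, 0; rewrite mulr0 addr0.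
  - by exists (a + c), (b + d); split; [exact: pD|rewrite mulrDr addrACA].
  - by exists (r * a), (r * b); split; [exact: pM|rewrite mulrDr mulrCA].
have sI : p `<=` I by move=> x px; exists x, 0; rewrite mulr0 addr0.
have [Ip|IT] := pmax I idI sI.
  case: npf; rewrite -Ip; exists 0, 1; split=> //.
  by rewrite add0r mulr1.
have [a [b [pa e]]] : I 1 by rewrite IT.
by exists b; rewrite e addrK.
Qed.

Lemma mem_inverse (p : set R) f g : is_ideal p -> p f -> p (1 - f * g) -> p 1.
Proof.
move=> [_ pD pM] pf p1; rewrite -(subrK (f * g) 1).
by apply: pD => //; rewrite mulrC; exact: pM.
Qed.

Definition basic_open f : set (Max R) := [set m | maximal_at m f].

Lemma basic_open_open f : open (basic_open f).
Proof.
exists (V f) => //.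
exists [set V f]; last by rewrite bigcup_set1.
by move=> _ ->; apply: (@finI_from1 _ _ _ id); exists f.
Qed.

(** The traces of the subbasic opens V(f) are a subbase of Max(R), so they
    suffice to test convergence. *)
Lemma cvg_basic_open (F : set_system (Max R)) m : Filter F ->
  (forall f, maximal_at m f -> F (basic_open f)) -> F --> m.
Proof.
move=> FF Fm A; rewrite nbhsE => -[_ [[_ [D DI <-] <-] [B DB Bm]] sUA].
have [E ED EB] := DI B DB.
apply: filterS (sUA) _.
suff : F (\bigcap_(i in [set` E]) (set_val @^-1` i)).
  apply: filterS => x Ex; exists B => //; rewrite -EB.
  by move=> i Ei; exact: Ex.
apply: filter_bigI => i Ei.
have [f _ fi] : range (@V R) i by apply/set_mem/ED.
have im : i (set_val m) by move: Bm; rewrite -EB; exact.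
by move: im; rewrite -fi; exact: Fm.
Qed.

Lemma maximal_prime (p : set R) : maximal_ideal p -> prime_ideal p.
Proof.
move=> mp; have [[p0 pD pM] pT _] := mp; split=> // x y pxy.
have [px|npx] := pselect (p x); [by left|right].
have [g pg] := maximal_inverse mp npx.
have -> : y = y * (1 - x * g) + g * (x * y) by ring.
by apply: pD; exact: pM.
Qed.

Lemma maximal_at_of (p : set R) : maximal_ideal p ->
  exists m, maximal_at m = p.
Proof.
move=> mp; have pp := maximal_prime mp.
have Mp : MkSpec pp \in Max R by exact/mem_set.
by exists (SigSub Mp); rewrite /maximal_at.
Qed.

(** Von Neumann regularity of R/J(R), expressed in R. *)
Definition regular_mod_jacobson : Prop :=
  forall f, exists g, jacobson_set (f - f * f * g).

Lemma regular_mod_jacobsonP : regular_mod_jacobson <->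
  forall f, exists g, forall m, maximal_at m f \/ maximal_at m (1 - f * g).
Proof.
have E f g : f - f * f * g = f * (1 - f * g) by rewrite mulrBr mulr1 mulrA.
split=> h f; have [g Hg] := h f; exists g; last first.
  move=> p mp; have [m <-] := maximal_at_of mp.
  have [[_ _ mM] _ _] := maximal_atP m.
  by rewrite E; have [mf|mg] := Hg m; [rewrite mulrC|]; exact: mM.
move=> m; have [_ _] := maximal_at_prime m; apply; rewrite -E.
exact: (Hg _ (maximal_atP m)).
Qed.

(** The index u ranges over the elements 1 - f g, filtered by divisibility;
    each point has a neighbourhood on which the dichotomy between f and u holds
    for all sufficiently divisible u, and compactness makes u uniform. *)
Lemma compact_regular :
  compact [set: Max R] -> regular_mod_jacobson.
Proof.
move=> /compact_near_coveringP cR; apply/regular_mod_jacobsonP => f.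
pose B g := [set u | exists h, u = (1 - f * g) * (1 - f * h)].
have BB g g' : B (g + g' - f * (g * g')) `<=` B g `&` B g'.
  have e1 a b : (1 - f * a) * (1 - f * b) = 1 - f * (a + b - f * (a * b)).
    by ring.
  move=> u [h ->]; split.
    by exists (g' + h - f * (g' * h)); rewrite -!e1 mulrA.
  by exists (g + h - f * (g * h)); rewrite -!e1 mulrA; congr (_ * _); rewrite mulrC.
have FF : Filter (filter_from setT B).
  apply: filter_from_filter; first by exists 0.
  by move=> g g' _ _; exists (g + g' - f * (g * g')).
have := cR _ _ (fun u m => maximal_at m f \/ maximal_at m u) FF.
case=> [m _|g _ sB].
  have [mf|nmf] := pselect (maximal_at m f).
    exists (basic_open f, setT); last by case=> m' u [m'f _]; left.
    split; last exact: filterT.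
    by apply: open_nbhs_nbhs; split=> //; exact: basic_open_open.
  have [g mg] := maximal_inverse (maximal_atP m) nmf.
  exists (basic_open (1 - f * g), B g).
    split; last by exists g.
    by apply: open_nbhs_nbhs; split=> //; exact: basic_open_open.
  case=> m' u [m'g [h ->]]; right.
  by have [[_ _ mM] _ _] := maximal_atP m'; rewrite mulrC; exact: mM.
exists g => m; apply: (sB _ _ m) => //.
by exists 0; rewrite mulr0 subr0 mulr1.
Qed.

Lemma regular_hausdorff : regular_mod_jacobson -> hausdorff_space (Max R).
Proof.
move=> /regular_mod_jacobsonP reg; rewrite open_hausdorff => p q npq.
have [f pf nqf] : exists2 f, maximal_at p f & ~ maximal_at q f.
  apply: contrapT => nex; case/eqP: npq; apply: maximal_at_inj.
  have [_ _ pmax] := maximal_atP p; have [[q0 qD qM] qT _] := maximal_atP q.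
  have spq : maximal_at p `<=` maximal_at q.
    by move=> f pf; apply: contrapT => nqf; apply: nex; exists f.
  by have [] := pmax _ (And3 q0 qD qM) spq.
have [g reg_g] := reg f.
exists (basic_open f, basic_open (1 - f * g)) => /=.
  by split; apply/mem_set => //; case: (reg_g q).
split; [exact: basic_open_open|exact: basic_open_open|].
apply/eqP/seteqP; split=> // m [mf mg].
have [mi mT _] := maximal_atP m.
exact: (proper_ideal1 mi mT (mem_inverse mi mf mg)).
Qed.

(** The dichotomy makes the basic opens clopen: an ultrafilter that omits V(f)
    contains V(1 - f g), which is what maximality of its limit requires. *)
Lemma regular_compact : regular_mod_jacobson -> compact [set: Max R].
Proof.
move=> /regular_mod_jacobsonP reg; rewrite compact_ultra => F UF _.
have FF := @ultra_proper _ _ UF.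
pose p := [set f | F (basic_open f)].
have idp : is_ideal p.
  split=> [|f g pf pg|a f pf].
  - by apply: filterS (filterT) => m _; have [[]] := maximal_atP m.
  - apply: filterS (filterI pf pg) => m [].
    by have [[_ D _] _ _] := maximal_atP m; exact: D.
  - apply: filterS pf => m.
    by have [[_ _ M] _ _] := maximal_atP m; exact: M.
have np1 : ~ p 1.
  move=> /filter_ex[m m1].
  by have [mi mT _] := maximal_atP m; exact: (proper_ideal1 mi mT m1).
have mp : maximal_ideal p.
  split=> // [pT|I idI sI]; first by apply: np1; rewrite pT.
  have [sp|nsp] := pselect (I `<=` p); first by left; exact/seteqP.
  right; have [f If npf] : exists2 f, I f & ~ p f.
    by apply: contrapT => nex; apply: nsp => f If; apply: contrapT => ?;
      apply: nex; exists f.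
  have [g reg_g] := reg f.
  have Ig : I (1 - f * g).
    apply: sI; have [//|Fn] := in_ultra_setVsetC (basic_open f) UF.
    by apply: filterS Fn => m nmf; case: (reg_g m).
  apply: contrapT => /(proper_ideal1 idI); apply.
  exact: mem_inverse If Ig.
have [m mE] := maximal_at_of mp.
exists m; split=> //; apply: cvg_basic_open => f.
by rewrite mE.
Qed.

Lemma compact_hausdorff_regular :
  compact_hausdorff (Max R) <-> regular_mod_jacobson.
Proof.
split=> [[cR _]|reg]; first exact: compact_regular.
by split; [exact: regular_compact|exact: regular_hausdorff].
Qed.

End FlatMaximalSpectrum.

(** * Tensor products *)

Section Subgroups.
Variables (K : choiceType) (A : zmodType).

Definition subgroup (G : set A) : Prop :=
  G 0 /\ forall x y, G x -> G y -> G (x - y).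

Lemma subgroupD (G : set A) x y : subgroup G -> G x -> G y -> G (x + y).
Proof.
by move=> [G0 GB] Gx Gy; rewrite -[y]opprK -[- y]add0r; apply: (GB) => //; exact: GB.
Qed.

Lemma freeg_ext_in (h : K -> A) (G : set A) (g : {freeg K}) :
  subgroup G -> (forall k, G (h k)) -> G (freeg_ext h g).
Proof.
move=> sG Gh; have [G0 GB] := sG.
have GMn x n : G x -> G (x *+ n).
  by move=> Gx; elim: n => // n IH; rewrite mulrS; exact: subgroupD.
rewrite /freeg_ext; apply: (big_ind (fun x => G x)) => // [x y|k _]; first exact: subgroupD.
case: (coeff k g) => n; first exact: GMn.
by rewrite NegzE mulrNz -[X in G X]add0r; apply: (GB) => //; exact: GMn.
Qed.

End Subgroups.

Section FreeGroupInduction.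
Variable K : choiceType.

(** Written as an extension along the generators, an element of the free group
    lies in every subgroup that contains them; this gives [freeg_ind]. *)
Lemma freeg_ext_id (g : {freeg K}) : freeg_ext (fun k => << k >>) g = g.
Proof.
rewrite -[RHS]freeg_sumE; apply: eq_bigr => k _.
by rewrite freegU_mulz intz.
Qed.

Lemma freeg_ind (P : {freeg K} -> Prop) : P 0 ->
  (forall g h, P g -> P h -> P (g - h)) -> (forall k, P << k >>) ->
  forall g, P g.
Proof.
move=> P0 PB Pk g; rewrite -(freeg_ext_id g).
exact: (@freeg_ext_in _ _ _ [set g | P g]).
Qed.

Lemma freeg_ext0 (A : zmodType) (h : K -> A) : freeg_ext h 0 = 0.
Proof. by rewrite -[X in freeg_ext _ X](subrr 0) freeg_extB subrr. Qed.

End FreeGroupInduction.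

Section TensorInduction.
Variables (S : comPzRingType) (N M : lmodType S).

Lemma tensor_pi0 : tensor_pi 0 = 0 :> tensor N M.
Proof. by rewrite -(subrr 0) tensor_piB subrr. Qed.

Lemma tensor_piK (t : tensor N M) : exists g, t = tensor_pi g.
Proof. by exists (repr t); rewrite /tensor_pi reprK. Qed.

Lemma tensor_ind (P : tensor N M -> Prop) : P 0 ->
  (forall t u, P t -> P u -> P (t - u)) -> (forall n m, P (tens n m)) ->
  forall t, P t.
Proof.
move=> P0 PB Pt t; have [g ->] := tensor_piK t.
elim/freeg_ind: g => [|g h Pg Ph|[n m]]; last exact: Pt.
  by rewrite tensor_pi0.
by rewrite tensor_piB; exact: PB.
Qed.

Lemma tens0r (n : N) : tens n 0 = 0 :> tensor N M.
Proof. by apply: (addrI (tens n 0)); rewrite -tensDr !addr0. Qed.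

Lemma tens0l m : tens (0 : N) m = 0 :> tensor N M.
Proof. by apply: (addrI (tens 0 m)); rewrite -tensDl !addr0. Qed.

Lemma tensBl (n n' : N) (m : M) : tens (n - n') m = tens n m - tens n' m.
Proof. by apply/eqP; rewrite eq_sym subr_eq -tensDl subrK. Qed.

Definition balanced_mod (A : zmodType) (G : set A) (h : N * M -> A) : Prop :=
  [/\ forall n n' m, G (h (n + n', m) - h (n, m) - h (n', m)),
      forall n m m', G (h (n, m + m') - h (n, m) - h (n, m'))
    & forall a n m, G (h (a *: n, m) - h (n, a *: m))].

(** The universal property of the tensor product, for maps that are balanced
    only modulo a subgroup: this avoids forming the quotient group A/G. *)
Lemma tensor_pi_ext (A : zmodType) (G : set A) (h : N * M -> A) g g' :
  subgroup G -> balanced_mod G h ->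
  tensor_pi g = tensor_pi g' -> G (freeg_ext h g - freeg_ext h g').
Proof.
move=> [G0 GB] [hDl hDr hZ] /tensor_piP; rewrite -freeg_extB.
elim=> {g g'} [n n' m|n m m'|a n m||g g' _ Gg _ Gg'].
- by rewrite !freeg_extB !freeg_extU.
- by rewrite !freeg_extB !freeg_extU.
- by rewrite !freeg_extB !freeg_extU.
- by rewrite freeg_ext0.
- by rewrite freeg_extB; exact: GB.
Qed.

End TensorInduction.

Section TensorMap.
Variables (S : comPzRingType) (N N' M : lmodType S) (f : {linear N -> N'}).

Lemma tensor_mapB : {morph @tensor_map S N N' M f : t u / t - u}.
Proof.
move=> t u; have [g ->] := tensor_piK t; have [h ->] := tensor_piK u.
by rewrite -tensor_piB !tensor_map_pi freeg_extB.
Qed.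

Lemma tensor_map0 : tensor_map f (0 : tensor N M) = 0.
Proof. by rewrite -[X in tensor_map _ X](subrr 0) tensor_mapB subrr. Qed.

(** If [phi] factors through [tensor_map f] modulo G, by way of a balanced map
    [r] on N' * M, then it sends the kernel of [tensor_map f] into G. *)
Lemma tensor_map_ker (A : zmodType) (G : set A) (r : N' * M -> A)
    (phi : tensor N M -> A) (t : tensor N M) :
  subgroup G -> balanced_mod G r -> {morph phi : t u / t - u} ->
  (forall n m, G (phi (tens n m) - r (f n, m))) ->
  tensor_map f t = 0 -> G (phi t).
Proof.
move=> sG br phiB phir; have [g ->] := tensor_piK t; have [G0 GB] := sG.
pose fg : {freeg N' * M} := freeg_ext (fun k => << (f k.1, k.2) >>) g.
have fgE : tensor_map f (tensor_pi g) = tensor_pi fg.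
  rewrite tensor_map_pi /fg; elim/freeg_ind: g {fg} => [|g h IHg IHh|k].
  - by rewrite !freeg_ext0 tensor_pi0.
  - by rewrite !freeg_extB tensor_piB IHg IHh.
  - by rewrite !freeg_extU.
rewrite fgE -(tensor_pi0 N' M) => /(tensor_pi_ext sG br).
rewrite freeg_ext0 subr0 => Gfg.
rewrite -(subrK (freeg_ext r fg) (phi _)); apply: subgroupD => //.
have phi0 : phi 0 = 0 by rewrite -[X in phi X](subrr 0) phiB subrr.
rewrite /fg; elim/freeg_ind: g {fg fgE Gfg} => [|g h IHg IHh|[n m]].
- by rewrite !freeg_ext0 tensor_pi0 phi0 subr0.
- by rewrite !freeg_extB tensor_piB phiB opprD addrACA -opprD; exact: GB.
- by rewrite !freeg_extU; exact: phir.
Qed.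

End TensorMap.

(** * Modules over von Neumann regular rings *)

Definition von_neumann_regular (S : comPzRingType) : Prop :=
  forall a : S, exists b, a = a * a * b.

Section RegularFlat.
Variables (S : comPzRingType) (regS : von_neumann_regular S).
Variables (N N' M : lmodType S) (f : {linear N -> N'}).

(** The image of D (x) M in N (x) M, that is, the kernel of
    N (x) M -> N/D (x) M, when D is a submodule. *)
Inductive tens_span (D : set N) : set (tensor N M) :=
| tens_span_tens n m : D n -> tens_span D (tens n m)
| tens_span0 : tens_span D 0
| tens_spanB t u : tens_span D t -> tens_span D u -> tens_span D (t - u).

Lemma tens_span_subgroup D : subgroup (tens_span D).
Proof. by split; [exact: tens_span0|exact: tens_spanB]. Qed.

Lemma tens_spanS D D' : D `<=` D' -> tens_span D `<=` tens_span D'.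
Proof.
move=> sD t; elim=> {t} [n m /sD|| t u _ ? _ ?].
- exact: tens_span_tens.
- exact: tens_span0.
- exact: tens_spanB.
Qed.

Definition tensor_scale (a : S) : tensor N M -> tensor N M :=
  tensor_map ( *:%R a : {linear N -> N}).

Lemma tens_span_scale a D D' : (forall n, D n -> D' (a *: n)) ->
  forall t, tens_span D t -> tens_span D' (tensor_scale a t).
Proof.
move=> sD t; elim=> {t} [n m Dn|| t u _ IHt _ IHu].
- by rewrite /tensor_scale tensor_map_tens; apply: tens_span_tens; exact: sD.
- rewrite -[X in tensor_scale _ X](subrr 0) /tensor_scale tensor_mapB subrr.
  exact: tens_span0.
- by rewrite /tensor_scale tensor_mapB; exact: tens_spanB.
Qed.

Lemma tensor_scale_split a t : t = tensor_scale a t + tensor_scale (1 - a) t.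
Proof.
elim/tensor_ind: t => [|t u {1}-> {1}->|n m].
- by rewrite -{2 3}(subrr 0) /tensor_scale !tensor_mapB !subrr addr0.
- by rewrite /tensor_scale !tensor_mapB opprD addrACA.
- by rewrite /tensor_scale !tensor_map_tens -tensDl -scalerDl addrC subrK scale1r.
Qed.

Definition submodule (C : set N') : Prop :=
  (forall x y, C x -> C y -> C (x + y)) /\ (forall a x, C x -> C (a *: x)).

Hypothesis injf : injective f.
Variable t : tensor N M.

(** Said of a submodule C, this means that t is nonzero in N/f^-1(C) (x) M. *)
Definition avoids (C : set N') : Prop :=
  submodule C /\ ~ tens_span (f @^-1` C) t.

(** A dying tensor dies at a finite stage, so chains of submodules avoiding t
    have upper bounds; injectivity of f makes 0 avoid t. *)
Lemma avoids_maximal : t <> 0 -> exists C, [/\ avoids C, C 0 &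
  forall B x, submodule B -> C `<=` B -> B x -> ~ C x ->
    tens_span (f @^-1` B) t].
Proof.
move=> t_neq0.
have [F sF totF|C [[smC nC] maxC]] := @Zorn_bigcup N' [set C | avoids C].
  split.
    split=> [x y [A FA Ax] [B FB By]|a x [A FA Ax]]; last first.
      by exists A => //; have [[_ AZ] _] := sF A FA; exact: AZ.
    have [sAB|sBA] := totF A B FA FB.
      by exists B => //; have [[BD _] _] := sF B FB; apply: BD => //; exact: sAB.
    by exists A => //; have [[AD _] _] := sF A FA; apply: AD => //; exact: sBA.
  suff H u : tens_span (f @^-1` (\bigcup_(X in F) X)) u ->
      u = 0 \/ exists2 C, F C & tens_span (f @^-1` C) u.
    by move=> /H[//|[C FC]]; have [_] := sF C FC.
  elim=> {u} [n m [C FC Cfn]|| u v _ IHu _ IHv].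
  - by right; exists C => //; exact: tens_span_tens.
  - by left.
  - case: IHu => [->|[A FA Au]]; case: IHv => [->|[B FB Bv]].
    + by left; rewrite subrr.
    + by right; exists B => //; apply: tens_spanB => //; exact: tens_span0.
    + by right; exists A => //; apply: tens_spanB => //; exact: tens_span0.
    + right; have [sAB|sBA] := totF A B FA FB.
        exists B => //; apply: tens_spanB => //.
        by apply: tens_spanS Au => n; exact: sAB.
      exists A => //; apply: tens_spanB => //.
      by apply: tens_spanS Bv => n; exact: sBA.
have maxC' B x : submodule B -> C `<=` B -> B x -> ~ C x ->
    tens_span (f @^-1` B) t.
  move=> smB sCB Bx nCx; apply: contrapT => nB.
  by apply: (maxC B); [split=> // /(_ x Bx)|split].
(* [Zorn_bigcup] may return the empty set, which [submodule] allows; 0 is then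
   a larger submodule that avoids t. *)
exists C; split=> //; apply: contrapT => nC0.
have C_empty x : ~ C x by move=> /(proj2 smC 0); rewrite scale0r.
have : tens_span (f @^-1` [set 0]) t.
  apply: (maxC' _ 0) => //; last by move=> x /C_empty.
  by split=> [x y -> ->|a x ->]; rewrite ?addr0 ?scaler0.
move=> span0; apply: t_neq0; elim: span0 => {maxC'} [n m|// | u v _ -> _ ->].
  by rewrite /preimage /= -(raddf0 f) => /injf ->; rewrite tens0l.
by rewrite subrr.
Qed.

Lemma regular_tensor_map_ker : tensor_map f t = 0 -> t = 0.
Proof.
move=> ft0; apply: contrapT => t_neq0.
have [C [[[CD CZ] nC] C0 maxC]] := avoids_maximal t_neq0.
have CB x y : C x -> C y -> C (x - y).
  by move=> Cx Cy; apply: CD => //; rewrite -scaleN1r; exact: CZ.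
have transporter e : submodule [set x | C (e *: x)].
  split=> [x y|a x] /=; first by rewrite scalerDr; exact: CD.
  by rewrite scalerA mulrC -scalerA; exact: CZ.
(* If neither e nor 1 - e kills N'/C, their kernels in N'/C are nonzero, so
   the images of t modulo both vanish; then e t and (1 - e) t vanish modulo C,
   and so does their sum t. *)
have idem e : e * e = e ->
    (forall x, C ((1 - e) *: x)) \/ (forall x, C (e *: x)).
  move=> ee; apply: contrapT => /not_orP[/existsNP[x nx] /existsNP[y ny]].
  have orth : e * (1 - e) = 0 by rewrite mulrBr mulr1 ee subrr.
  have span_e : tens_span (f @^-1` [set x | C (e *: x)]) t.
    apply: maxC nx => //; first by move=> z; exact: CZ.
    by rewrite /= scalerA orth scale0r.
  have span_e' : tens_span (f @^-1` [set x | C ((1 - e) *: x)]) t.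
    apply: maxC ny => //; first by move=> z; exact: CZ.
    by rewrite /= scalerA mulrC orth scale0r.
  apply: nC; rewrite (tensor_scale_split e t).
  apply: subgroupD; first exact: tens_span_subgroup.
    by apply: tens_span_scale span_e => n; rewrite /preimage /= linearZ.
  by apply: tens_span_scale span_e' => n; rewrite /preimage /= linearZ.
(* If x \notin f(N) + C then C + S x meets f(N) within C, against maximality:
   where f n = c + a x, the idempotent a b either is 1 on N'/C, so that
   x = b (a x) = f (b n) modulo C, or it is 0, so that a x \in C. *)
have dense x : exists n, C (x - f n).
  apply: contrapT => nex; apply: nC.
  have nCx : ~ C x by move=> Cx; apply: nex; exists 0; rewrite raddf0 subr0.
  pose D := [set y | exists c a, C c /\ y = c + a *: x].
  have spanD : tens_span (f @^-1` D) t.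
    apply: (maxC D x) => //.
    - split=> [y z [c [a [Cc ->]]] [d [b [Cd ->]]]|r y [c [a [Cc ->]]]].
        by exists (c + d), (a + b); split; [exact: CD|rewrite scalerDl addrACA].
      exists (r *: c), (r * a); split; first exact: CZ.
      by rewrite scalerDr scalerA.
    - by move=> c Cc; exists c, 0; rewrite scale0r addr0.
    - by exists 0, 1; rewrite scale1r add0r.
  apply: tens_spanS spanD => n [c [a [Cc fnE]]].
  have [b aab] := regS a.
  have abab : (a * b) * (a * b) = a * b by rewrite mulrACA mulrA -aab.
  have [C1|Cab] := idem _ abab.
    case: nex; exists (b *: n).
    have -> : x - f (b *: n) = (1 - a * b) *: x - b *: c.
      rewrite linearZ /= fnE scalerDr scalerBl scale1r scalerA [b * a]mulrC.
      by rewrite -addrA -opprD [b *: c + _]addrC.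
    by apply: CB => //; exact: CZ.
  rewrite /preimage /= fnE; apply: CD => //.
  by rewrite aab -mulrA -scalerA; exact: CZ.
(* Modulo C, the choice s is an S-linear inverse of f; it factors the identity
   of N (x) M modulo [G] through [tensor_map f]. *)
pose s x := xget 0 [set n | C (x - f n)].
have sP x : C (x - f (s x)).
  exact: (@xgetPex _ 0 [set n | C (x - f n)] (dense x)).
pose G := tens_span (f @^-1` C).
have GB n n' m : C (f (n - n')) -> G (tens n m - tens n' m).
  by move=> Cn; rewrite -tensBl; exact: tens_span_tens.
apply: nC; apply: (@tensor_map_ker _ _ _ _ f _ G
  (fun k => tens (s k.1) k.2) id t) ft0 => //.
- exact: tens_span_subgroup.
- split=> [x y m|x m m'|a x m] /=.
  + rewrite -addrA -opprD -tensDl; apply: GB.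
    rewrite raddfB raddfD /=.
    have -> : f (s (x + y)) - (f (s x) + f (s y)) =
      (x - f (s x)) + (y - f (s y)) - (x + y - f (s (x + y))).
      by rewrite addrACA -opprD opprB [RHS]addrC addrA subrK.
    by apply: CB => //; exact: CD.
  + by rewrite tensDr -addrA -opprD subrr; exact: tens_span0.
  + rewrite -tensZ; apply: GB; rewrite linearB linearZ /=.
    have -> : f (s (a *: x)) - a *: f (s x) =
      a *: (x - f (s x)) - (a *: x - f (s (a *: x))).
      by rewrite scalerBr opprB [RHS]addrC addrA subrK.
    by apply: CB => //; exact: CZ.
- by move=> n m; apply: GB; rewrite raddfB; exact: sP.
Qed.

End RegularFlat.

Lemma regular_absolutely_flat (S : comPzRingType) :
  von_neumann_regular S -> absolutely_flat S.
Proof.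
move=> regS M N N' f injf t u ftu; apply/eqP; rewrite -subr_eq0; apply/eqP.
apply: (regular_tensor_map_ker regS injf).
by rewrite tensor_mapB ftu subrr.
Qed.

(** * Regularity from flatness *)

Section CyclicModule.
Variables (S : comPzRingType) (I : ideal S).

(** S/I as an S-module: an alias, since the quotient ring already carries the
    structures of a ring. *)
Definition cyclic_module : Type := quotient_ring I.

HB.instance Definition _ := GRing.Zmodule.on cyclic_module.
HB.instance Definition _ := EqQuotient.on cyclic_module.

Let pi (x : S) : cyclic_module := \pi_(quotient_ring I) x.

Let piD : {morph pi : x y / x + y}.
Proof.
by move=> x y; exact: (Quotient.pi_add (GRing.ZmodClosed.clone S (ideal_mem I) _) x y).
Qed.

Let pi_mul x y : quotient_mul (pi x) (pi y) = pi (x * y).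
Proof. exact: quotient_mulE. Qed.

Definition cyclic_scale (a : S) (x : cyclic_module) : cyclic_module :=
  quotient_mul (pi a) x.

Lemma cyclic_scaleA a b x :
  cyclic_scale a (cyclic_scale b x) = cyclic_scale (a * b) x.
Proof. by rewrite /cyclic_scale quotient_mulA pi_mul. Qed.

Lemma cyclic_scale1 : left_id 1 cyclic_scale.
Proof. exact: quotient_mul1. Qed.

Lemma cyclic_scaleDr : right_distributive cyclic_scale +%R.
Proof.
move=> a x y; rewrite /cyclic_scale !(quotient_mulC (pi a)).
exact: quotient_mulDl.
Qed.

Lemma cyclic_scaleDl x : {morph cyclic_scale^~ x : a b / a + b}.
Proof. by move=> a b; rewrite /cyclic_scale piD; exact: quotient_mulDl. Qed.

HB.instance Definition _ := GRing.Zmodule_isLmodule.Build S cyclic_module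
  cyclic_scaleA cyclic_scale1 cyclic_scaleDr cyclic_scaleDl.

Definition cyclic_gen (x : S) : cyclic_module := pi x.

Lemma cyclic_genP x y : cyclic_gen x = cyclic_gen y <-> ideal_set I (x - y).
Proof. exact: quotient_ringP. Qed.

Lemma cyclic_genD : {morph cyclic_gen : x y / x + y}.
Proof. exact: piD. Qed.

Lemma cyclic_gen0 : cyclic_gen 0 = 0.
Proof. by apply: (addrI (cyclic_gen 0)); rewrite -cyclic_genD !addr0. Qed.

Lemma cyclic_genZ a x : a *: cyclic_gen x = cyclic_gen (a * x).
Proof. exact: pi_mul. Qed.

Lemma cyclic_genK (x : cyclic_module) : cyclic_gen (repr x) = x.
Proof. exact: (@reprK _ (quotient_ring I)). Qed.

End CyclicModule.

Definition annihilator_ideal (S : comPzRingType) (a : S) : ideal S.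
Proof.
exists [set x | x * a = 0]; split=> [|x y xa ya|c x xa] /=.
- by rewrite mul0r.
- by rewrite mulrDl xa ya addr0.
- by rewrite -mulrA xa mulr0.
Defined.

Definition principal_ideal (S : comPzRingType) (a : S) : ideal S.
Proof.
exists [set x | exists c, x = c * a]; split=> [|x y [c ->] [d ->]|c x [d ->]].
- by exists 0; rewrite mul0r.
- by exists (c + d); rewrite mulrDl.
- by exists (c * d); rewrite mulrA.
Defined.

Section MulEmbedding.
Variables (S : comPzRingType) (a : S).

Definition mul_emb (x : cyclic_module (annihilator_ideal a)) : S^o :=
  repr x * a.

Lemma mul_emb_gen x : mul_emb (cyclic_gen _ x) = x * a.
Proof.
have /cyclic_genP/= : cyclic_gen (annihilator_ideal a)
    (repr (cyclic_gen (annihilator_ideal a) x)) = cyclic_gen _ x.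
  exact: cyclic_genK.
by move/eqP; rewrite mulrBl subr_eq0 => /eqP.
Qed.

Lemma mul_emb_linear : linear mul_emb.
Proof.
move=> c x y; rewrite -(cyclic_genK x) -(cyclic_genK y).
by rewrite cyclic_genZ -cyclic_genD !mul_emb_gen mulrDl -mulrA.
Qed.

HB.instance Definition _ := GRing.isLinear.Build S
  (cyclic_module (annihilator_ideal a)) S^o *:%R mul_emb mul_emb_linear.

Lemma mul_emb_inj : injective mul_emb.
Proof.
move=> x y exy; rewrite -(cyclic_genK x) -(cyclic_genK y).
by apply/cyclic_genP => /=; rewrite mulrBl; apply/eqP; rewrite subr_eq0; apply/eqP.
Qed.

End MulEmbedding.

Lemma absolutely_flat_regular (S : comPzRingType) :
  absolutely_flat S -> von_neumann_regular S.
Proof.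
move=> flatS a.
pose I := annihilator_ideal a; pose J := principal_ideal a.
have tens0 : tens (cyclic_gen I 1) (cyclic_gen J 1) = 0.
  have inj := @flatS (cyclic_module J) _ _ (@mul_emb S a) (@mul_emb_inj S a).
  apply: (inj); rewrite tensor_map0 tensor_map_tens /= mul_emb_gen mul1r.
  rewrite (_ : a = a *: (1 : S^o)); last by rewrite /GRing.scale /= mulr1.
  rewrite tensZ cyclic_genZ mulr1 -(tens0r _ (1 : S^o)); congr tens.
  by rewrite -cyclic_gen0; apply/cyclic_genP; exists 1; rewrite subr0 mul1r.
(* G = Ann(a) + (a), and h is the multiplication S/Ann(a) * S/(a) -> S/G. *)
pose G : set S := [set z | exists c, z * a = c * a * a].
have sG : subgroup G.
  split=> [|x y [c cE] [d dE]]; first by exists 0; rewrite !mul0r.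
  by exists (c - d); rewrite !mulrBl cE dE.
have [_ GB] := sG.
pose h (k : cyclic_module I * cyclic_module J) : S := repr k.1 * repr k.2.
have hE x y : G (h (cyclic_gen I x, cyclic_gen J y) - x * y).
  rewrite /h /=; set u := repr _; set v := repr _.
  have /cyclic_genP/= ux : cyclic_gen I u = cyclic_gen I x by exact: cyclic_genK.
  have /cyclic_genP[c vy] : cyclic_gen J v = cyclic_gen J y by exact: cyclic_genK.
  exists (u * c); transitivity (u * (v - y) * a + y * ((u - x) * a)); first by ring.
  by rewrite ux vy mulr0 addr0 !mulrA.
have bh : balanced_mod G h.
  split=> [n n' m|n m m'|c n m].
  - rewrite -(cyclic_genK n) -(cyclic_genK n') -(cyclic_genK m) -cyclic_genD.
    move: (repr n) (repr n') (repr m) => x x' y.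
    rewrite -[X in G X](_ : h (cyclic_gen I (x + x'), cyclic_gen J y)
      - (x + x') * y - (h (cyclic_gen I x, cyclic_gen J y) - x * y)
      - (h (cyclic_gen I x', cyclic_gen J y) - x' * y) = _); last by ring.
    by apply: (GB); [apply: (GB)|]; exact: hE.
  - rewrite -(cyclic_genK n) -(cyclic_genK m) -(cyclic_genK m') -cyclic_genD.
    move: (repr n) (repr m) (repr m') => x y y'.
    rewrite -[X in G X](_ : h (cyclic_gen I x, cyclic_gen J (y + y'))
      - x * (y + y') - (h (cyclic_gen I x, cyclic_gen J y) - x * y)
      - (h (cyclic_gen I x, cyclic_gen J y') - x * y') = _); last by ring.
    by apply: (GB); [apply: (GB)|]; exact: hE.
  - rewrite -(cyclic_genK n) -(cyclic_genK m) !cyclic_genZ.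
    move: (repr n) (repr m) => x y.
    rewrite -[X in G X](_ : h (cyclic_gen I (c * x), cyclic_gen J y)
      - c * x * y - (h (cyclic_gen I x, cyclic_gen J (c * y)) - x * (c * y))
      = _); last by ring.
    by apply: (GB); exact: hE.
have := tensor_pi_ext sG bh (etrans tens0 (esym (tensor_pi0 _ _))).
rewrite freeg_ext0 freeg_extU subr0 => Gh.
have [c] : G 1.
  rewrite -(subKr (h (cyclic_gen I 1, cyclic_gen J 1)) 1).
  by apply: (GB) => //; rewrite -[X in _ - X]mulr1; exact: hE.
by rewrite mul1r => e; exists c; rewrite mulrC mulrA.
Qed.

(** * The Jacobson quotient *)

Lemma quotient_von_neumann_regular (R : comPzRingType) (I : ideal R) :
  von_neumann_regular (quotient_ring I) <->
  forall f : R, exists g, ideal_set I (f - f * f * g).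
Proof.
have piE (f g : R) : \pi_(quotient_ring I) (f * f * g) =
    \pi_(quotient_ring I) f * \pi_(quotient_ring I) f * \pi_(quotient_ring I) g.
  by rewrite -2!quotient_mulE.
split=> [reg f|reg].
  have [y] := reg (\pi_(quotient_ring I) f); elim/quotW: y => g.
  by rewrite -piE => /quotient_ringP; exists g.
elim/quotW=> f; have [g Ig] := reg f.
by exists (\pi_(quotient_ring I) g); rewrite -piE; exact/quotient_ringP.
Qed.

Theorem theorem4p5 (R : comPzRingType) :
  compact_hausdorff (Max R) <-> absolutely_flat (quotient_ring (jacobson R)).
Proof.
apply: (iff_trans (compact_hausdorff_regular R)).
apply: (iff_trans (iff_sym (quotient_von_neumann_regular (jacobson R)))).
by split; [exact: regular_absolutely_flat|exact: absolutely_flat_regular].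
Qed.
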